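(* For every real $\alpha>\frac{1}{2}$ there exist an integer $N_0$ and a constant $C$ such that the following holds. Let $G$ be a simple edge-colored graph with $n\geq N_0$ vertices and exactly $n$ colors (so its edge set is partitioned into $n$ color classes), and suppose at least $\alpha n$ of the color classes are each either a matching of size $2$ or a triangle. Then $G$ contains a rainbow cycle of length at most $C\log n$.
   Context: An edge-colored graph is a graph $G$ with a map $c:E(G)\to\mathbb{N}$; the color classes are the sets $F_i=\{e\in E(G): c(e)=i\}$. A subgraph is rainbow if its distinct edges have distinct colors (come from distinct color classes). A matching of size $2$ is a set of two vertex-disjoint edges; a triangle is the edge set of a $3$-cycle. Logarithms are to base $2$. *)

(* Defs.v *)
From HB Require Import structures.
From mathcomp Require Import all_boot all_order all_algebra.
From mathcomp Require Import reals exp.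

Set Implicit Arguments.
Unset Strict Implicit.
Unset Printing Implicit Defensive.

Import Order.TTheory GRing.Theory Num.Theory.

Local Open Scope ring_scope.

(* A simple graph on T, given by its set of 2-element edges. The map [color]  *)
(* is total on {set T}, but only its values on edges matter.                  *)
Record ecgraph (T : finType) := ECGraph {
  edges : {set {set T}};
  edges_card2 : forall e, e \in edges -> #|e| = 2%N;
  color : {set T} -> nat
}.

Section Defs.
Variable T : finType.
Implicit Types (G : ecgraph T) (F : {set {set T}}) (p : seq T).

(* The colors actually used, so every color class below is nonempty. *)
Definition colors G : seq nat := undup [seq color G e | e <- enum (edges G)].

Definition color_class G (i : nat) : {set {set T}} :=
  [set e in edges G | color G e == i].

Definition cycle_edges p : {set {set T}} := [set [set x; next p x] | x in p].

(* p lists the vertices of the cycle in cyclic order, so its length is size p. *)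
Definition is_cycle G p : bool :=
  [&& (3 <= size p)%N, uniq p & cycle_edges p \subset edges G].

Definition rainbow G F : Prop := {in F &, injective (color G)}.

Definition matching2 F : bool := (#|F| == 2%N) && trivIset F.

Definition triangle F : bool :=
  [exists p : 3.-tuple T, uniq p && (F == cycle_edges p)].

Definition good_colors G : seq nat :=
  [seq i <- colors G | matching2 (color_class G i) || triangle (color_class G i)].

End Defs.

Definition log2 (R : realType) (x : R) : R := ln x / ln 2.

(* Main.v *)
(* Fix one edge in each color class that is not good. These edges cover at    *)
(* most 2(1 - alpha)n vertices, so a linear number of vertices Z is left. A   *)
(* good class spans at most 6 vertices, so a maximal set D of low-degree      *)
(* vertices of Z meeting every good class in at most one vertex has linear    *)
(* size. Deleting D keeps an edge of every color, which leaves a rainbow      *)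
(* graph with n edges on at most (1 - delta)n vertices.                       *)
(*   In a minimal induced subgraph of edge density at least 1 + 1/k, any      *)
(* vertex set U is met by at least (1 + 1/k)|U| edges. Balls therefore grow   *)
(* by a factor 1 + 1/k until, at some radius r = O(log n), a ball spans more  *)
(* edges than its BFS tree; an extra edge closes a cycle of length <= 2r + 1. *)

Require Import Defs.
From HB Require Import structures.
From mathcomp Require Import all_boot all_order all_algebra.
From mathcomp Require Import reals exp.
From mathcomp Require Import zify lra.

Set Implicit Arguments.
Unset Strict Implicit.
Unset Printing Implicit Defensive.

Import Order.TTheory GRing.Theory Num.Theory.

(** A graph whose edges outnumber its vertices by a constant factor has a cycle of logarithmic
    length ([short_cycle_of_dense]). So it suffices to keep one edge of each color while discarding
    linearly many vertices ([colors_survive]): with only one edge per color, every cycle found is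
    rainbow ([short_rainbow_cycle]). The threshold 1/2 comes from the bad classes. Each is protected
    by reserving the two ends of one of its edges, which costs at most $2(1-\alpha)n < n$ vertices.
    A good class survives the loss of any one vertex ([good_class_avoids]), so among the unreserved
    vertices it is enough to discard a set meeting each good class at most once;
    [independent_subset] finds a large one. *)

Section ShortCycles.
Variable T : finType.
Implicit Types (E F : {set {set T}}) (U W B : {set T}) (s : seq {set T}).

(** * Logarithmic cycles in graphs of density above 1 *)

Definition adj E : rel T := [rel x y | [set x; y] \in E].

Definition nbhd E U : {set T} := U :|: [set y | [exists x in U, adj E x y]].

Definition ball E (v : T) r : {set T} := iter r (nbhd E) [set v].

Definition induced E W : {set {set T}} := [set e in E | e \subset W].

Lemma adj_sym E : symmetric (adj E).
Proof. by move=> x y; rewrite /adj /= setUC. Qed.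

Lemma adj_sub E F : E \subset F -> subrel (adj E) (adj F).
Proof. by move=> sEF x y; apply: (subsetP sEF). Qed.

Lemma path_rev_adj E x p :
  path (adj E) x p -> path (adj E) (last x p) (rev (belast x p)).
Proof.
by move=> px; rewrite rev_path (eq_path (e' := adj E)) // => a b; apply: adj_sym.
Qed.

(** Shorten the walk to a simple path and close it with the removed edge. *)
Lemma cycle_of_path E x y p :
    {in E, forall e : {set T}, #|e| = 2} -> [set x; y] \in E ->
    path (adj (E :\ [set x; y])) x p -> last x p = y ->
  exists c, [/\ 3 <= size c, uniq c, cycle_edges c \subset E &
               size c <= (size p).+1].
Proof.
move=> E2 Exy px; case/shortenP: px => p' px' Up' sub lastp'.
have nxy : x != y by have := E2 _ Exy; rewrite cards2; case: eqP.
have cyc : cycle (adj E) (x :: p').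
  rewrite /= rcons_path lastp' adj_sym /adj /= Exy andbT.
  by apply: sub_path px'; apply/adj_sub/subsetDl.
exists (x :: p'); split => //.
(* A simple path with no step would give [x = y]; one with a single step would use the removed
   edge. *)
- case: p' px' lastp' {Up' sub cyc} => [|a [|b p']] //=.
    by move=> _ e; rewrite e eqxx in nxy.
  by rewrite andbT => + e; rewrite e /adj /= !inE eqxx.
- apply/subsetP => _ /imsetP [z zp ->].
  exact: (next_cycle cyc zp).
- rewrite ltnS; apply: uniq_leq_size => [|z zp]; last exact: sub.
  by case/andP: Up'.
Qed.

(** Breadth-first search: each new vertex contributes only the edge to a parent in the previous
    ball, while the root contributes none, hence the strict bound. *)
Lemma ball_spanning_tree E v r :
  exists F, [/\ F \subset E, #|F| < #|ball E v r| &
    forall u, u \in ball E v r ->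
      exists p, [/\ path (adj F) u p, last u p = v & size p <= r]].
Proof.
elim: r => [|r [F [sFE ltF HF]]].
  exists set0; split; rewrite ?sub0set ?cards0 ?cards1 // => u.
  by rewrite inE => /eqP ->; exists [::].
set B := ball E v r in ltF HF *.
have -> : ball E v r.+1 = nbhd E B by [].
pose par u := odflt u [pick x in B | adj E x u].
have parP u : u \in nbhd E B :\: B -> par u \in B /\ adj E u (par u).
  rewrite !inE => /andP [/negPf ->] /= /existsP [x /andP [xB xu]].
  rewrite /par; case: pickP => [y /andP [yB yu]|/(_ x)]; last by rewrite xB xu.
  by split => //=; rewrite adj_sym.
pose F1 := [set [set u; par u] | u in nbhd E B :\: B].
exists (F :|: F1); split.
- rewrite subUset sFE; apply/subsetP => _ /imsetP [u /parP [_ ?] ->] //.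
- have -> : #|nbhd E B| = #|B| + #|nbhd E B :\: B|.
    have sB : B \subset nbhd E B by apply: subsetUl.
    by rewrite -(cardsID B (nbhd E B)) (setIidPr sB).
  rewrite (leq_ltn_trans (leq_card_setU _ _)) //.
  by rewrite -addSn leq_add // leq_imset_card.
- have sF : subrel (adj F) (adj (F :|: F1)) by apply/adj_sub/subsetUl.
  move=> u uN; case: (boolP (u \in B)) => [/HF [p [pp lp sp]]|uB].
    by exists p; split; [apply: sub_path pp | | apply: leqW].
  have uNB : u \in nbhd E B :\: B by rewrite inE uB.
  have [/HF [p [pp lp sp]] _] := parP _ uNB.
  exists (par u :: p); split => //=; rewrite (sub_path sF pp) andbT.
  by rewrite /adj /= inE; apply/orP; right; apply: imset_f.
Qed.

Lemma cycle_of_dense_ball E v r :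
    {in E, forall e : {set T}, #|e| = 2} ->
    #|ball E v r| <= #|induced E (ball E v r)| ->
  exists c, [/\ 3 <= size c, uniq c, cycle_edges c \subset E &
               size c <= (2 * r).+1].
Proof.
move=> E2 dense; have [F [sFE ltF HF]] := ball_spanning_tree E v r.
have [e eB eF] : exists2 e, e \in induced E (ball E v r) & e \notin F.
  apply/subsetPn; apply/negP => /subset_leq_card.
  by rewrite leqNgt (leq_trans ltF dense).
move: eB; rewrite inE => /andP [eE eB].
have /eqP/cards2P [x [y [nxy exy]]] := E2 _ eE; subst e.
have xB : x \in ball E v r by apply: (subsetP eB); rewrite !inE eqxx.
have yB : y \in ball E v r by apply: (subsetP eB); rewrite !inE eqxx orbT.
have [p [pp lp sp]] := HF x xB.
have [q [pq lq sq]] := HF y yB.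
have sF : subrel (adj F) (adj (E :\ [set x; y])).
  apply: adj_sub; apply/subsetP => f fF; rewrite inE (subsetP sFE _ fF) andbT.
  by rewrite inE; apply: contraNneq eF => <-.
(* Walk from [x] down the tree to [v], then back up to [y]; at most [2 * r] steps, none along the
   extra edge. *)
have pw : path (adj (E :\ [set x; y])) x (p ++ rev (belast y q)).
  rewrite cat_path (sub_path sF pp) lp -lq /=.
  exact: (sub_path sF (path_rev_adj pq)).
have lw : last x (p ++ rev (belast y q)) = y.
  by rewrite last_cat lp -lq; case: (q) => //= a q'; rewrite rev_cons last_rcons.
have [c [c3 Uc cE cs]] := cycle_of_path E2 eE pw lw.
exists c; split => //; apply: (leq_trans cs).
by rewrite ltnS size_cat size_rev size_belast mul2n -addnn leq_add.
Qed.

Lemma expn_succ_double k : 0 < k -> 2 * k ^ k <= k.+1 ^ k.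
Proof.
case: k => // k _.
(* Bernoulli's inequality for $(1+1/(k+1))^j$ with denominators cleared; [j = k.+1] gives the factor
   2. *)
have H j : (k.+1 + j) * k.+1 ^ j <= k.+1 * k.+2 ^ j.
  elim: j => [|j IH]; first by rewrite !expn0; lia.
  rewrite !expnS; have := leq_mul (leqnn k.+2) IH.
  set a := k.+1 ^ j; set b := k.+2 ^ j; nia.
by have := H k.+1; rewrite addnn -mul2n [2 * _]mulnC -mulnA leq_pmul2l.
Qed.

(** Growth by $1+1/k$ per step at least doubles over every [k] steps. *)
Lemma growth_bound (f : nat -> nat) k m : 0 < k -> 0 < f 0 ->
  (forall r, r < k * m -> k.+1 * f r <= k * f r.+1) -> 2 ^ m <= f (k * m).
Proof.
move=> k0 f0 H.
have {}H r : r <= k * m -> k.+1 ^ r <= k ^ r * f r.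
  elim: r => [|r IH] rm; first by rewrite !expn0 mul1n.
  rewrite !expnS.
  have := leq_mul (leqnn (k ^ r)) (H r rm).
  have := leq_mul (leqnn k.+1) (IH (ltnW rm)).
  set a := k ^ r; set b := k.+1 ^ r; nia.
have {}H := H _ (leqnn _).
have kp : 0 < k ^ (k * m) by rewrite expn_gt0 k0.
rewrite -(leq_pmul2l kp); apply: leq_trans H.
rewrite !expnM -expnMn mulnC; case: (posnP m) => [->|m0]; first by rewrite !expn0.
by rewrite leq_exp2r ?expn_succ_double.
Qed.

Lemma short_cycle_of_dense E W k m : 0 < k ->
    {in E, forall e : {set T}, #|e| = 2} ->
    W != set0 -> k.+1 * #|W| <= k * #|induced E W| -> #|T| < 2 ^ m ->
  exists c, [/\ 3 <= size c, uniq c, cycle_edges c \subset E &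
               size c <= (2 * (k * m)).+1].
Proof.
move=> k0 E2 W0 dW Tm.
pose P V := (V != set0) && (k.+1 * #|V| <= k * #|induced E V|).
have [|V /minsetP [/andP [V0 dV] minV] sVW] := @minset_exists _ P W.
  by rewrite /P W0.
(* By minimality of [V]. The empty set is separate, since [P] only admits nonempty sets. *)
have sparse U : U \proper V -> k * #|induced E U| <= k.+1 * #|U|.
  move=> sUV; case: (eqVneq U set0) => [->|U0].
    rewrite [induced _ _](_ : _ = set0) ?cards0 ?muln0 //.
    apply/setP => e; rewrite !inE subset0; apply/negP => /andP [eE /eqP e0].
    by have := E2 _ eE; rewrite e0 cards0.
  case: (leqP (k * #|induced E U|) (k.+1 * #|U|)) => // /ltnW lt.
  have UV := minV U _ (proper_sub sUV).
  by rewrite UV ?properxx // /P U0 in sUV.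
pose E' := induced E V.
have sE' : E' \subset E by apply/subsetP => e; rewrite inE => /andP [].
have E'2 : {in E', forall e : {set T}, #|e| = 2}.
  by move=> e /(subsetP sE'); apply: E2.
have [v vV] := set0Pn _ V0.
have nbhdV U : U \subset V -> nbhd E' U \subset V.
  move=> sUV; rewrite subUset sUV; apply/subsetP => y; rewrite !inE.
  case/existsP => x /andP [_]; rewrite /adj /= inE => /andP [_ /subsetP]; apply.
  by rewrite !inE eqxx orbT.
have ballV r : ball E' v r \subset V.
  by elim: r => [|r IH]; [rewrite sub1set | apply: nbhdV].
have ball0 r : v \in ball E' v r.
  by elim: r => [|r IH]; rewrite !inE ?eqxx // IH.
(* Deleting [U] from [V] leaves a sparse graph, so at least $(1+1/k)|U|$ edges meet [U], and all of
   them lie inside its neighborhood. *)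
have expand U : U != set0 -> U \subset V ->
    k.+1 * #|U| <= k * #|induced E' (nbhd E' U)|.
  move=> U0 sUV.
  have prop : V :\: U \proper V.
    rewrite properE subsetDl; apply/subsetPn.
    have [u uU] := set0Pn _ U0; exists u; first exact: (subsetP sUV).
    by rewrite inE uU.
  have sV : E' \subset induced E (V :\: U) :|: induced E' (nbhd E' U).
    apply/subsetP => e eE'; have := eE'; rewrite inE => /andP [eE eV].
    rewrite inE [in X in X || _]inE [in X in _ || X]inE eE eE' /=.
    case: (boolP (e \subset V :\: U)) => //= /subsetPn [x xe].
    rewrite inE (subsetP eV _ xe) andbT negbK => xU.
    apply/subsetP => y ye; rewrite !inE; case: (eqVneq y x) => [->|nyx].
      by rewrite xU.
    apply/orP; right; apply/existsP; exists x; rewrite xU /=.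
    suff exy : [set x; y] = e by rewrite /adj /= exy.
    apply/eqP; rewrite eqEcard E'2 // cards2 eq_sym nyx andbT.
    by rewrite subUset !sub1set xe ye.
  have /= H1 := leq_trans (subset_leq_card sV) (leq_card_setU _ _).
  have H2 := sparse _ prop.
  have H3 : #|V| = #|U| + #|V :\: U| by rewrite -(cardsID U V) (setIidPr sUV).
  rewrite -(leq_add2r (k.+1 * #|V :\: U|)) -mulnDr -H3 (leq_trans dV) //.
  by rewrite (leq_trans (leq_mul (leqnn k) H1)) // mulnDr addnC leq_add2l.
case: (boolP [exists r : 'I_(k * m).+1,
                #|ball E' v r| <= #|induced E' (ball E' v r)|]).
  case/existsP => r /(cycle_of_dense_ball E'2) [c [c3 Uc cE cs]].
  exists c; split => //; first exact: subset_trans cE sE'.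
  by apply: leq_trans cs _; rewrite ltnS leq_mul2l -ltnS ltn_ord orbT.
(* If no ball up to radius [k * m] spans as many edges as vertices, [expand] makes the balls grow by
   $1+1/k$ each step, past $2^m > |T|$. *)
move/existsPn => small.
have := @growth_bound (fun r => #|ball E' v r|) k m k0.
rewrite /= cards1 => /(_ isT) H.
suff /H : forall r, r < k * m -> k.+1 * #|ball E' v r| <= k * #|ball E' v r.+1|.
  by move/leq_trans/(_ (max_card _)); rewrite leqNgt Tm.
move=> r rm; have rm' : r.+1 < (k * m).+1 by [].
have /= := small (Ordinal rm'); rewrite -ltnNge => /ltnW lt.
apply: leq_trans (leq_mul (leqnn k) lt).
by apply: expand => //; apply/set0Pn; exists v.
Qed.

(** * Large sets meeting each member of a family at most once *)

Lemma sum_count_mem s :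
  \sum_x count (fun A : {set T} => x \in A) s = \sum_(A <- s) #|A|.
Proof.
elim: s => [|A s IH]; first by rewrite big_nil big1.
rewrite big_cons -IH /= big_split /=; congr (_ + _).
by rewrite -sum1_card [RHS]big_mkcond; apply: eq_bigr => x _; case: (x \in A).
Qed.

(** A maximal independent set in a conflict graph of bounded degree is linear in size. The degree is
    bounded by first dropping the vertices of [Z] lying in too many sets. *)
Lemma independent_subset s (Z : {set T}) c q :
    0 < c -> size s <= #|T| -> {in s, forall A : {set T}, #|A| <= c} ->
    #|T| <= q * #|Z| ->
  exists D : {set T},
    [/\ D \subset Z, {in s, forall A : {set T}, #|A :&: D| <= 1} &
        #|T| <= 2 * q * (2 * c ^ 2 * q).+1 * #|D|].
Proof.
move=> c0 ss sc Zq.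
pose deg x := count (fun A : {set T} => x \in A) s.
pose Z' := [set x in Z | deg x <= 2 * c * q].
have sum_deg : \sum_x deg x <= c * #|T|.
  rewrite sum_count_mem; apply: (@leq_trans (\sum_(A <- s) c)).
    by rewrite big_seq [X in _ <= X]big_seq; apply: leq_sum.
  by rewrite big_const_seq count_predT iter_addn_0 leq_mul2l ss orbT.
(* By double counting, at most $|T|/(2q)$ vertices have degree above [2 * c * q], which is at most
   half of [Z]. *)
have Z'q : #|T| <= 2 * q * #|Z'|.
  have few : 2 * c * q * #|Z :\: Z'| <= c * #|T|.
    apply: leq_trans sum_deg; rewrite mulnC -sum_nat_const.
    rewrite [X in _ <= X](bigID (mem (Z :\: Z'))) /=.
    apply: leq_trans (leq_addr _ _); apply: leq_sum => x.
    by rewrite !inE => /andP [+ xZ]; rewrite xZ /= -ltnNge => /ltnW.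
  have {}few : 2 * q * #|Z :\: Z'| <= #|T|.
    by rewrite -(leq_pmul2l c0); apply: leq_trans few; rewrite !mulnA [c * 2]mulnC.
  have : #|Z| = #|Z'| + #|Z :\: Z'|.
    have sZ : Z' \subset Z by apply/subsetP => x; rewrite inE => /andP [].
    by rewrite -(cardsID Z' Z) (setIidPr sZ).
  move: Zq few; nia.
pose P (D : {set T}) := (D \subset Z') && all (fun A : {set T} => #|A :&: D| <= 1) s.
have [|D /maxsetP [/andP [DZ' /allP Ds] maxD] _] := @maxset_exists _ P set0.
  by rewrite /P sub0set; apply/allP => A _; rewrite setI0 cards0.
exists D; split => //.
  by apply: subset_trans DZ' _; apply/subsetP => x; rewrite inE => /andP [].
(* By maximality, each [z] of [Z'] outside [D] shares a set of [s] with some [d] in [D], so these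
   neighborhoods cover [Z']. *)
pose N d := d |: \bigcup_(A <- s | d \in A) A.
have cover : Z' \subset \bigcup_(d in D) N d.
  apply/subsetP => z zZ'; apply/bigcupP.
  case: (boolP (z \in D)) => [zD|zD]; first by exists z; rewrite // !inE eqxx.
  have : ~~ P (z |: D).
    by apply: contra zD => /maxD <-; rewrite ?subsetUr // !inE eqxx.
  rewrite /P subUset sub1set zZ' DZ' /= => /allPn [A As]; rewrite -ltnNge => lt.
  have zA : z \in A.
    apply: contraLR lt => zA; rewrite -leqNgt.
    suff -> : A :&: (z |: D) = A :&: D by apply: Ds.
    apply/setP => x; rewrite !inE; case: eqVneq => [->|//].
    by rewrite (negPf zA).
  have [d] : exists d, d \in A :&: D.
    apply/set0Pn; apply: contraTneq lt => AD; rewrite -leqNgt setIUr AD setU0.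
    by rewrite (leq_trans (subset_leq_card (subsetIr _ _))) ?cards1.
  rewrite inE => /andP [dA dD]; exists d => //.
  rewrite inE; apply/orP; right.
  by rewrite (big_rem A As) /= dA inE zA.
have Nle d : d \in D -> #|N d| <= (2 * c ^ 2 * q).+1.
  move=> /(subsetP DZ'); rewrite inE => /andP [_ dd].
  rewrite (leq_trans (leq_card_setU _ _)) // cards1 add1n ltnS.
  apply: (@leq_trans (c * deg d)); last by move: dd; nia.
  rewrite /deg; elim: s sc {ss deg Z' sum_deg Z'q P D DZ' Ds maxD N cover dd}
    => [|A s IH] sc; first by rewrite big_nil cards0.
  have {}IH := IH (fun B Bs => sc B (mem_behead (s := A :: s) Bs)).
  rewrite big_cons /=; case: (d \in A) => //=.
  rewrite (leq_trans (leq_card_setU _ _)) // mulnDr muln1 leq_add //.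
  by rewrite sc ?mem_head.
have {}cover : #|Z'| <= (2 * c ^ 2 * q).+1 * #|D|.
  apply: leq_trans (subset_leq_card cover) _.
  apply: (@leq_trans (\sum_(d in D) #|N d|)).
    elim/big_rec2: _ => [|d n U _ IH]; first by rewrite cards0.
    by rewrite (leq_trans (leq_card_setU _ _)) // leq_add2l.
  by rewrite mulnC -sum_nat_const; apply: leq_sum.
by apply: leq_trans Z'q _; rewrite -(mulnA (2 * q)) leq_mul.
Qed.

End ShortCycles.

(** * Rainbow subgraphs on few vertices *)

Section RainbowCycles.
Variables (T : finType) (G : ecgraph T).

(** The one structural fact used about good classes beyond their size: they are not stars. *)
Lemma good_class_avoids (F : {set {set T}}) (v : T) :
  matching2 F || triangle F -> exists2 e : {set T}, e \in F & v \notin e.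
Proof.
case/orP.
  case/andP => /cards2P [e [f [nef ->]]] /trivIsetP /(_ e f).
  rewrite !inE !eqxx orbT => /(_ isT isT nef) /disjointFr dis.
  case: (boolP (v \in e)) => [/dis|] ve; last by exists e; rewrite // !inE eqxx.
  by exists f; rewrite ?ve // !inE eqxx orbT.
case/existsP => -[[|x [|y [|z [|]]]] //= sz] /andP [].
rewrite !inE !andbT negb_or => /andP [/andP [nxy nxz] nyz] /eqP ->.
have Fxy : [set x; y] \in cycle_edges [:: x; y; z].
  by apply/imsetP; exists x; rewrite ?inE ?eqxx //= eqxx.
have Fyz : [set y; z] \in cycle_edges [:: x; y; z].
  by apply/imsetP; exists y; rewrite ?inE ?eqxx ?orbT //= eq_sym (negPf nxy) eqxx.
have Fzx : [set z; x] \in cycle_edges [:: x; y; z].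
  apply/imsetP; exists z; rewrite ?inE ?eqxx ?orbT //=.
  by rewrite !(eq_sym z) (negPf nxz) (negPf nyz) eqxx.
case: (eqVneq v x) => [->|nvx].
  by exists [set y; z]; rewrite // !inE negb_or nxy.
case: (eqVneq v y) => [->|nvy].
  by exists [set z; x]; rewrite // !inE negb_or nyz eq_sym.
by exists [set x; y]; rewrite // !inE negb_or nvx.
Qed.

Lemma good_class_card (F : {set {set T}}) :
  matching2 F || triangle F -> #|F| <= 3.
Proof.
case/orP => [/andP [/eqP ->] //|/existsP [p /andP [_ /eqP ->]]].
by rewrite (leq_trans (leq_imset_card _ _)) // (leq_trans (card_size _)) ?size_tuple.
Qed.

Lemma color_classP i e :
  reflect (e \in edges G /\ color G e = i) (e \in color_class G i).
Proof. by rewrite inE; apply: (iffP andP) => -[? /eqP]. Qed.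

Lemma color_class_neq0 i : i \in colors G -> exists e, e \in color_class G i.
Proof.
rewrite mem_undup => /mapP [e]; rewrite mem_enum => eE ->.
by exists e; apply/color_classP.
Qed.

Lemma card_good_cover i :
  i \in good_colors G -> #|cover (color_class G i)| <= 6.
Proof.
rewrite mem_filter => /andP [/good_class_card F3 _].
apply: leq_trans (leq_card_cover _) _.
rewrite (eq_bigr (fun _ => 2)) => [|e /color_classP [/edges_card2]] //.
by rewrite sum_nat_const; lia.
Qed.

(** With $g$ good colors, the hypothesis says $q(2g-n) \geq n$, and $2g-n = n-2(n-g)$ is a lower
    bound for the number of unreserved vertices. The 72 is $2c^2$ at $c=6$. *)
Lemma colors_survive q :
    size (colors G) = #|T| ->
    #|T| + q * #|T| <= 2 * q * size (good_colors G) ->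
  exists D : {set T},
    #|T| <= 2 * q * (72 * q).+1 * #|D| /\
    forall i, i \in colors G ->
      exists2 e, e \in color_class G i & e \subset ~: D.
Proof.
move=> nT gq.
pose good i := matching2 (color_class G i) || triangle (color_class G i).
pose bad := [seq i <- colors G | ~~ good i].
have sz : size (good_colors G) + size bad = #|T|.
  by rewrite -nT -(count_predC good (colors G)) /good_colors !size_filter.
pose rep i := odflt set0 [pick e in color_class G i].
have repP i : i \in colors G -> rep i \in color_class G i.
  move/color_class_neq0 => [e eF]; rewrite /rep.
  by case: pickP => [//|/(_ e)]; rewrite eF.
pose K := \bigcup_(i <- bad) rep i.
have cardK : #|K| <= 2 * size bad.
  rewrite /K; have : {subset bad <= colors G} by move=> i; rewrite mem_filter => /andP [].
  elim: bad {K sz} => [|i s IH] sub; first by rewrite big_nil cards0.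
  rewrite big_cons (leq_trans (leq_card_setU _ _)) // mulnS leq_add //.
    by have /repP/color_classP [/edges_card2 ->] := sub i (mem_head _ _).
  by apply: IH => j js; apply: sub; rewrite inE js orbT.
pose s := [seq cover (color_class G i) | i <- good_colors G].
have [||A /mapP [i ig ->]||D [DZ Ds Dn]] := @independent_subset T s (~: K) 6 q.
- by [].
- by rewrite size_map; lia.
- exact: card_good_cover.
- by have := cardsC K; move: gq sz cardK; nia.
exists D; split => // i ic.
case: (boolP (good i)) => [gi|bi]; last first.
  exists (rep i); first exact: repP.
  apply: (@subset_trans _ _ K); last by rewrite -[K]setCK setCS.
  by rewrite /K (big_rem i) ?mem_filter ?bi //= subsetUl.
have ig : i \in good_colors G by rewrite mem_filter ic andbT.
have := Ds _ (map_f (fun i => cover (color_class G i)) ig).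
rewrite leq_eqVlt ltnS leqn0 => CD.
(* If the class misses [D] altogether, any vertex serves as [v]; an end of one of its edges is
   taken. *)
suff [v Cv] : exists v, cover (color_class G i) :&: D \subset [set v].
  have [e eF ve] := good_class_avoids v gi; exists e => //.
  apply/subsetP => x xe; rewrite inE; apply: contra ve => xD.
  have : x \in cover (color_class G i) :&: D.
    by rewrite inE xD andbT; apply/bigcupP; exists e.
  by move/(subsetP Cv); rewrite inE => /eqP <-.
case/orP: CD => [/cards1P [v ->]|]; first by exists v.
rewrite cards_eq0 => /eqP ->.
have [e /color_classP [/edges_card2 /eqP /cards2P [v _] _]] := color_class_neq0 ic.
by exists v; rewrite sub0set.
Qed.

Lemma short_rainbow_cycle q m :
    0 < #|T| -> 0 < q -> size (colors G) = #|T| ->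
    #|T| + q * #|T| <= 2 * q * size (good_colors G) -> #|T| < 2 ^ m ->
  exists p, [/\ is_cycle G p, rainbow G (cycle_edges p) &
    size p <= (2 * (2 * q * (72 * q).+1 * m)).+1].
Proof.
move=> T0 q0 nT gq Tm; have [D [Dn HD]] := colors_survive nT gq.
set k := 2 * q * _ in Dn *.
have k0 : 0 < k by rewrite !muln_gt0 q0.
pose rep i := odflt set0 [pick e in color_class G i | e \subset ~: D].
have repP i : i \in colors G -> rep i \in color_class G i /\ rep i \subset ~: D.
  move/HD => [e eF eD]; rewrite /rep.
  by case: pickP => [f /andP [] //|/(_ e)]; rewrite eF eD.
pose E := [set e in [seq rep i | i <- colors G]].
have EP e : e \in E ->
    [/\ e \in edges G, e \subset ~: D & rep (color G e) = e].
  rewrite inE => /mapP [i /repP [/color_classP [eE ei] eD] ->].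
  by split; rewrite ?ei.
have cardE : #|E| = #|T|.
  rewrite cardsE -nT -(size_map rep); apply/card_uniqP.
  rewrite map_inj_in_uniq ?undup_uniq // => i j.
  move=> /repP [/color_classP [_ ci] _] /repP [/color_classP [_ cj] _] rij.
  by rewrite -ci rij.
have E2 : {in E, forall e : {set T}, #|e| = 2}.
  by move=> e /EP [/edges_card2].
have indE : induced E (~: D) = E.
  by apply/setP => e; rewrite inE andb_idr // => /EP [].
have W0 : ~: D != set0.
  have /card_gt0P [e eE] : 0 < #|E| by rewrite cardE.
  have [_ eD _] := EP _ eE; apply: contraTneq eD => ->.
  by rewrite subset0 -cards_eq0 E2.
(* From $n \leq k|D|$ it follows that $(k+1)(n-|D|) \leq kn$. *)
have dense : k.+1 * #|~: D| <= k * #|induced E (~: D)|.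
  by rewrite indE cardE; have := cardsC D; move: Dn; nia.
have [c [c3 Uc cE cs]] := short_cycle_of_dense k0 E2 W0 dense Tm.
exists c; split => //.
- rewrite /is_cycle c3 Uc /=; apply: subset_trans cE _.
  by apply/subsetP => e /EP [].
- move=> e f /(subsetP cE)/EP [_ _ re] /(subsetP cE)/EP [_ _ rf] ef.
  by rewrite -re ef rf.
Qed.

End RainbowCycles.

(** * Choice of the constants *)

Local Open Scope ring_scope.

Lemma trunc_log2_le_log2 (R : realType) n :
  (0 < n)%N -> (trunc_log 2 n)%:R <= log2 (n%:R : R).
Proof.
move=> n0; have ln2 : 0 < ln (2 : R) by rewrite ln_gt0 // ltr1n.
rewrite /log2 ler_pdivlMr // mulr_natl -lnXn ?ltr0n //.
by rewrite ler_ln ?posrE ?exprn_gt0 ?ltr0n // -natrX ler_nat trunc_logP.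
Qed.

Theorem theorem1p5 (R : realType) (alpha : R) (halpha : 1 / 2 < alpha) :
  exists (N0 : nat) (C : R),
    forall (T : finType) (G : ecgraph T),
      (N0 <= #|T|)%N ->
      size (colors G) = #|T| ->
      alpha * #|T|%:R <= (size (good_colors G))%:R ->
      exists p : seq T,
        [/\ is_cycle G p,
            rainbow G (cycle_edges p) &
            (size p)%:R <= C * log2 (#|T|%:R)].
Proof.
have gamma0 : 0 < 2 * alpha - 1 by lra.
pose q := (Num.truncn (2 * alpha - 1)^-1).+1.
have hq : 1 <= q%:R * (2 * alpha - 1).
  by rewrite -ler_pdivrMr // div1r; apply/ltW/truncnS_gt.
pose k := (2 * q * (72 * q).+1)%N.
exists 2%N, (4 * k + 1)%:R => T G n2 nT hgood.
have n0 : (0 < #|T|)%N by apply: leq_trans n2.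
have gq : (#|T| + q * #|T| <= 2 * q * size (good_colors G))%N.
  rewrite -(ler_nat R) natrD !natrM.
  have h1 : #|T|%:R <= q%:R * (2 * alpha - 1) * #|T|%:R by rewrite ler_peMl.
  have h2 : q%:R * (alpha * #|T|%:R) <= q%:R * (size (good_colors G))%:R.
    by rewrite ler_wpM2l.
  by lra.
have [p [pc pr ps]] := short_rainbow_cycle n0 (ltn0Sn _) nT gq
  (trunc_log_ltn #|T| (ltnSn 1)).
exists p; split => //.
(* With $t$ the truncated logarithm and $m=t+1$, the bound $2k(t+1)+1 \leq (4k+1)t$ needs $t \geq
   1$; this is why [N0] is 2. *)
have tl1 : (1 <= trunc_log 2 #|T|)%N by rewrite trunc_log_gt0.
apply: (@le_trans _ _ ((4 * k + 1)%:R * (trunc_log 2 #|T|)%:R)).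
  by rewrite -natrM ler_nat (leq_trans ps) // -/k; nia.
by rewrite ler_wpM2l // trunc_log2_le_log2.
Qed.
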